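(* Let $\Sigma$ be a $C^6$ smooth nonhorizontal curve in $\mathbb{H}$, parameterized by homogeneous arclength. Let $x=\Sigma(0)$ and set $\gamma=\pi\circ\Sigma$. Then, as $r\to0^+$, $$\mathcal{S}^2(B_H(x,r)\cap\Sigma)=2r^2+\mathbf{b}_1(x)r^6+\mathbf{b}_2(x)r^{10}+\mathbf{b}_3(x)r^{14}+o(r^{14}),$$ where, for $m=1,2,3$, $\mathbf{b}_m(x)$ is a weighted homogeneous polynomial in the quantities $g_{ij}(0)$ and $\omega_{ij}(0)$ of total weight $4m$.
   Context: The first Heisenberg group $\mathbb{H}$ is $\mathbb{R}^3$ with the group law $(x_1,x_2,x_3)*(y_1,y_2,y_3)=(x_1+y_1,\,x_2+y_2,\,x_3+y_3-2x_1y_2+2x_2y_1)$. It is equipped with the Korányi metric $d_H(x,y)=\|x^{-1}*y\|_H$, where $\|(x_1,x_2,x_3)\|_H^4=(x_1^2+x_2^2)^2+x_3^2$. $B_H(x,r)$ is the closed $d_H$-ball with center $x$ and radius $r$. The projection $\pi:\mathbb{H}\to\mathbb{R}^2$ is $\pi(x_1,x_2,x_3)=(x_1,x_2)$. The contact form is $\vartheta=dx_3+2x_1\,dx_2-2x_2\,dx_1$. Curves are one-dimensional embedded submanifolds of $\mathbb{R}^3$ given by regular parameterizations $\Sigma:I\to\mathbb{H}$ on an open interval $I$ (here $0\in I$); $\Sigma$ also denotes the image. A curve is (fully) nonhorizontal if $\vartheta(\dot\Sigma(s))\neq0$ for all $s$, and it is parameterized by homogeneous arclength if $\vartheta(\dot\Sigma(s))=1$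 for all $s$. For vectors in $\mathbb{R}^2$ let $g(v,w)=v_1w_1+v_2w_2$ and $\omega(v,w)=v_1w_2-v_2w_1$. With $\gamma^{(i)}$ the $i$-th derivative of $\gamma$, put $g_{ij}=g(\gamma^{(i)},\gamma^{(j)})$ and $\omega_{ij}=\omega(\gamma^{(i)},\gamma^{(j)})$ for $i,j\geq1$. The weight associated to an index $i$ is $2i-1$, so $g_{ij}$ and $\omega_{ij}$ both have weight $(2i-1)+(2j-1)$ (e.g. $g_{11}$ has weight $2$ and $\omega_{12}$ has weight $4$); weights add under multiplication. The polynomials $\mathbf b_m$ have constant coefficients not depending on $\Sigma$. $\mathcal{S}^2$ is the $2$-dimensional spherical Hausdorff measure of $(\mathbb{H},d_H)$ (defined by coverings with $d_H$-balls), rescaled by a constant so that $\mathcal{S}^2(\Sigma(J))=\int_J|\vartheta(\dot\Sigma(s))|\,ds$ for every fully nonhorizontal curve $\Sigma$ and every interval $J$ in its domain. *)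

(* Defs.v *)
From HB Require Import structures.
From mathcomp Require Import all_boot all_order all_algebra.
From mathcomp Require Import all_classical all_reals all_analysis.
(* The notations of [mpoly] clash with those of MathComp-Analysis. *)
From mathcomp Require Import -(notations) mpoly.

Set Implicit Arguments.
Unset Strict Implicit.
Unset Printing Implicit Defensive.

Import Order.TTheory GRing.Theory Num.Theory.
Import numFieldNormedType.Exports.

Local Open Scope ring_scope.
Local Open Scope classical_set_scope.

Section Heisenberg.
Context {R : realType}.

(* The points of H are those of R^3: (x1, x2, x3) is the nested pair
   ((x1, x2), x3); the product topology is the Euclidean one. *)
Notation heis := (R * R * R)%type.
Implicit Types (x y v : heis).

Definition heis_mul x y : heis :=
  (x.1.1 + y.1.1, x.1.2 + y.1.2,
   x.2 + y.2 - 2 * x.1.1 * y.1.2 + 2 * x.1.2 * y.1.1).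

Definition heis_inv x : heis := (- x.1.1, - x.1.2, - x.2).

Definition koranyi x : R :=
  ((x.1.1 ^+ 2 + x.1.2 ^+ 2) ^+ 2 + x.2 ^+ 2) `^ 4^-1.

Definition dH x y : R := koranyi (heis_mul (heis_inv x) y).

Definition ballH x (r : R) : set heis := [set y | dH x y <= r].

Definition piH x : R * R := x.1.

(* The contact form at the point [x], applied to the tangent vector [v]. *)
Definition vartheta x v : R := v.2 + 2 * x.1.1 * v.1.2 - 2 * x.1.2 * v.1.1.

Definition is_Ck_on (V : normedModType R) (k : nat) (D : set R) (f : R -> V) :=
  (forall j s, (j < k)%N -> D s -> derivable f^`(j) s 1) /\
  (forall s, D s -> {for s, continuous f^`(k)}).

Definition contact_speed (S : R -> heis) (s : R) : R := vartheta (S s) (S^`() s).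

(* [S] is only meaningful on the open interval [I].  The continuous left
   inverse [g] on the image says that [S] is injective on [I] and a
   homeomorphism from [I] onto [S @` I]. *)
Record is_curve (k : nat) (I : set R) (S : R -> heis) : Prop := IsCurve {
  curve_open : open I;
  curve_interval : is_interval I;
  curve_Ck : is_Ck_on k I S;
  curve_regular : forall s, I s -> S^`() s != 0;
  curve_embedded : exists2 g : heis -> R,
    (forall s, I s -> g (S s) = s) & {within S @` I, continuous g} }.

Definition nonhorizontal (I : set R) (S : R -> heis) :=
  forall s, I s -> contact_speed S s != 0.

Definition homogeneous_arclength (I : set R) (S : R -> heis) :=
  forall s, I s -> contact_speed S s = 1.

Definition diamH (E : set heis) : \bar R :=
  ereal_sup [set (dH x y)%:E | x in E & y in E].

(* Coverings are by sequences of closed balls of positive radius. *)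
Definition spherical_content (delta : R) (E : set heis) : \bar R :=
  ereal_inf [set (\sum_(0 <= n <oo) diamH (ballH (p n).1 (p n).2) ^+ 2)%E
            | p in [set p : nat -> heis * R |
                     [/\ forall n, 0 < (p n).2,
                         forall n, (diamH (ballH (p n).1 (p n).2) <= delta%:E)%E
                       & E `<=` \bigcup_n ballH (p n).1 (p n).2]]].

Definition spherical_hausdorff (E : set heis) : \bar R :=
  ereal_sup [set spherical_content delta E
            | delta in [set delta : R | 0 < delta]].

Definition sphericalS2 (c : R) (E : set heis) : \bar R :=
  (c%:E * spherical_hausdorff E)%E.

(* The property that determines the rescaling constant [c]; no regularity
   beyond C^1 is imposed on the curves. *)
Definition normalizes_S2 (c : R) :=
  0 < c /\
  forall (I : set R) (S : R -> heis), is_curve 1 I S -> nonhorizontal I S ->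
  forall J : set R, is_interval J -> J `<=` I ->
    sphericalS2 c (S @` J) =
    (\int[lebesgue_measure]_(s in J) `|contact_speed S s|%:E)%E.

Definition planar_g (v w : R * R) : R := v.1 * w.1 + v.2 * w.2.

Definition planar_omega (v w : R * R) : R := v.1 * w.2 - v.2 * w.1.

End Heisenberg.

(* Formal variables: [inl (i, j)] is g_{i+1,j+1} and [inr (i, j)] is
   omega_{i+1,j+1}, so that the derivative indices range over 1..6, i.e. over
   all the derivatives that a C^6 curve has.  An index i contributes the weight
   2i - 1, so no index above 6 can occur in weight at most 12. *)
Definition jet_var : finType := ('I_6 * 'I_6 + 'I_6 * 'I_6)%type.

Definition jet_var_weight (u : jet_var) : nat :=
  match u with
  | inl (i, j) | inr (i, j) => (2 * i.+1 - 1) + (2 * j.+1 - 1)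
  end.

Definition jet_weight (m : multinom #|jet_var|) : nat :=
  \sum_k m k * jet_var_weight (enum_val k).

Lemma jet_weight0 : jet_weight mnm0 = 0%N.
Proof. by rewrite /jet_weight big1 // => k _; rewrite mnm0E. Qed.

Lemma jet_weightD :
  {morph jet_weight : m1 m2 / mnm_add m1 m2 >-> (m1 + m2)%N}.
Proof.
move=> m1 m2; rewrite /jet_weight -big_split /=.
by apply: eq_bigr => k _; rewrite mnmDE mulnDl.
Qed.

HB.instance Definition _ :=
  isMeasure.Build #|jet_var| jet_weight jet_weight0 jet_weightD.

Definition jet_poly (R : realType) := mpoly #|jet_var| R.

Definition weighted_homogeneous (R : realType) (d : nat) (b : jet_poly R) : Prop :=
  b \is ishomog1 d jet_weight.

Definition jet_value (R : realType) (gamma : R -> R * R) (u : jet_var) : R :=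
  match u with
  | inl (i, j) => planar_g (gamma^`(i.+1) 0) (gamma^`(j.+1) 0)
  | inr (i, j) => planar_omega (gamma^`(i.+1) 0) (gamma^`(j.+1) 0)
  end.

Definition jet_eval (R : realType) (gamma : R -> R * R) (b : jet_poly R) : R :=
  meval (fun k => jet_value gamma (enum_val k)) b.

(* Main.v *)
(* Put F(s) = d_H(Sigma(0), Sigma(s))^4.  Left translation gives
   F = |gamma - gamma(0)|^4 + t^2 with
   t' = 1 - 2 omega(gamma - gamma(0), gamma'), so that Taylor's formula yields
   F(s) = s^2 (P(s) + o(s^6)), where P(0) = 1 and the coefficient of s^k in P is
   weighted homogeneous of weight 2k in the g_ij and omega_ij.  The formal
   equation P(x M(x)) M(x)^2 = 1 + O(x^7) has a polynomial solution M whose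
   coefficients M_k are again of weight 2k.  Near 0, F increases with |s|;
   comparing F with x^2 at the points x (M(x) +- e x^6), x = r^2 and x = - r^2,
   traps the sublevel set {F <= r^4} between two intervals.  By the normalization,
   S^2(B_H(Sigma(0), r) /\ Sigma) is the length of this set, that is
   r^2 (M(r^2) + M(- r^2)) + o(r^14), in which only M_0 = 1, M_2, M_4 and M_6
   survive. *)
Require Import Defs.
From mathcomp Require Import all_boot all_order all_algebra.
From mathcomp Require Import all_classical all_reals all_analysis.
From mathcomp Require Import measurable_realfun.
From mathcomp Require Import ring lra zify.
From mathcomp Require Import -(notations) mpoly.

Set Implicit Arguments.
Unset Strict Implicit.
Unset Printing Implicit Defensive.

Import Order.TTheory GRing.Theory Num.Theory.
Import numFieldNormedType.Exports.

Local Open Scope ring_scope.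
Local Open Scope classical_set_scope.

(** * Formal reversion *)

Section Reversion.
Variable A : comNzRingType.
Implicit Types P M p q r : {poly A}.

(* If a(s) = s^2 P(s) then [reversion P M] is a(x M(x)) / x^2. *)
Definition reversion P M : {poly A} := (P \Po ('X * M)) * M ^+ 2.

(** The induction is Horner's scheme. Divisibility by [q - r] shows below that changing [M] at order
    n changes [P \Po ('X * M)] only at order n+1. *)
Lemma comp_polyB_factor p q r : exists s, (p \Po q) - (p \Po r) = (q - r) * s.
Proof.
elim/poly_ind: p => [|p c [s IH]].
  by exists 0; rewrite !comp_poly0 subrr mulr0.
exists ((p \Po q) + s * r).
rewrite !comp_polyD !comp_polyM !comp_polyX !comp_polyC.
rewrite -[p \Po q](subrK (p \Po r)) IH; ring.
Qed.

Lemma poly_head p : p`_0 = 1 -> exists q, p = 1 + 'X * q.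
Proof.
elim/poly_ind: p => [|p c _ ] h.
  by move: h; rewrite coef0 => /esym/eqP; rewrite oner_eq0.
exists p; move: h; rewrite coefD coefMX coefC /= add0r => ->.
by rewrite addrC mulrC.
Qed.

(** The argument ['X * M] is shifted at order n+1 only, so at order n just the factor [M ^+ 2]
    reacts. Its cross term has leading coefficient 2c, as [M] and [P] start with 1, and the term in
    [c ^+ 2] has order 2n, at least n+1. *)
Lemma reversion_perturb P M c n : P`_0 = 1 -> M`_0 = 1 -> (0 < n)%N ->
  exists Q, reversion P (M + c *: 'X^n) =
            reversion P M + (c *+ 2) *: 'X^n + 'X^(n.+1) * Q.
Proof.
move=> /poly_head [p ep] /poly_head [m em] n0.
have [s es] := comp_polyB_factor P ('X * (M + c *: 'X^n)) ('X * M).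
have eN : 'X^n = 'X * 'X^(n.-1) :> {poly A} by rewrite -exprS prednK.
have eP : P \Po ('X * M) = 1 + 'X * (M * (p \Po ('X * M))).
  by rewrite ep comp_polyD comp_polyM comp_polyX -[1]/(1%:P) comp_polyC; ring.
exists ((c%:P * s) * (M + c *: 'X^n) ^+ 2 +
  (P \Po ('X * M)) * (c%:P ^+ 2 * 'X^(n.-1)) +
  (c *+ 2)%:P * (m + M * (M * (p \Po ('X * M))))).
move/eqP: es; rewrite subr_eq => /eqP es.
rewrite /reversion es -!mul_polyC polyCMn [in 'X^(n.+1)]exprS eP eN.
by move: (p \Po _) => z; rewrite em; ring.
Qed.

End Reversion.

Lemma map_reversion (A B : comNzRingType) (f : {rmorphism A -> B}) P M :
  map_poly f (reversion P M) = reversion (map_poly f P) (map_poly f M).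
Proof.
by rewrite /reversion rmorphM rmorphXn /= map_comp_poly rmorphM /= map_polyX.
Qed.

(** * Weighted homogeneity of the formal solution *)

Section Graded.
Variable R : realType.
Implicit Types p q : {poly jet_poly R}.

(* The arclength parameter has weight -2. *)
Definition graded p := forall k, weighted_homogeneous (2 * k) p`_k.

Lemma graded0 : graded 0.
Proof. by move=> k; rewrite coef0; exact: dhomog0. Qed.

Lemma gradedD p q : graded p -> graded q -> graded (p + q).
Proof.
by move=> hp hq k; rewrite coefD; apply: dhomogD; [exact: hp|exact: hq].
Qed.

Lemma gradedN p : graded p -> graded (- p).
Proof.
by move=> hp k; rewrite coefN /weighted_homogeneous dhomogN; exact: hp.
Qed.

Lemma gradedM p q : graded p -> graded q -> graded (p * q).
Proof.
move=> hp hq k; rewrite coefM; apply: rpred_sum => i _.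
have -> : (2 * k = 2 * i + 2 * (k - i))%N.
  by rewrite -mulnDr subnKC // -ltnS.
by apply: dhomogM; [exact: hp|exact: hq].
Qed.

Lemma gradedZXn a n : weighted_homogeneous (2 * n) a -> graded (a *: 'X^n).
Proof.
move=> ha k; rewrite coefZ coefXn; case: eqP => [->|_].
  by rewrite mulr1.
by rewrite mulr0; exact: dhomog0.
Qed.

Lemma graded1 : graded 1.
Proof.
rewrite -[1]/('X^0) -[X in graded X]scale1r.
by apply: gradedZXn; exact: dhomog1.
Qed.

Lemma gradedX p n : graded p -> graded (p ^+ n).
Proof.
move=> hp; elim: n => [|n IH]; first exact: graded1.
by rewrite exprS; exact: gradedM.
Qed.

Lemma graded_sum (I : Type) (s : seq I) (Q : pred I)
    (F : I -> {poly jet_poly R}) :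
  (forall i, Q i -> graded (F i)) -> graded (\sum_(i <- s | Q i) F i).
Proof. by move=> h; apply: big_ind => //; [exact: graded0|exact: gradedD]. Qed.

(** The indeterminate alone is not graded, but each monomial of [P] is. The composition is therefore
    expanded with the power of ['X] attached to the coefficient of [P] and separated from the power
    of [M]. *)
Lemma graded_reversion P M : graded P -> graded M -> graded (reversion P M).
Proof.
move=> hP hM; apply: gradedM; last exact: gradedX.
rewrite comp_polyE; apply: graded_sum => i _.
by rewrite exprMn scalerAl; apply: gradedM; [exact: gradedZXn|exact: gradedX].
Qed.

(** The equation is solved one coefficient at a time: each new coefficient of [M] cancels the lowest
    term of the current error. *)
Lemma reversion_solve P n : graded P -> P`_0 = 1 ->
  exists M, [/\ graded M, M`_0 = 1, (size M <= n.+1)%N &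
                exists Q, reversion P M = 1 + 'X^(n.+1) * Q].
Proof.
move=> hP P0; elim: n => [|n [M [hM M0 sM [Q eQ]]]].
  exists 1; split; [exact: graded1|by rewrite coefC|by rewrite size_poly1|].
  have [p ep] := poly_head P0.
  exists (p \Po 'X); rewrite /reversion mulr1 expr1n mulr1 ep.
  by rewrite comp_polyD comp_polyM comp_polyX -[1]/(1%:P) comp_polyC.
(* Adding [a *: 'X^(n.+1)] contributes 2a at order n+1, which has to cancel the constant coefficient
   of [Q]. The latter is the coefficient of index n+1 of the graded polynomial [reversion P M],
   hence has the right weight. *)
pose a : jet_poly R := - (2^-1 : R) *: Q`_0.
have ha : weighted_homogeneous (2 * n.+1) a.
  apply: dhomogZ; have := graded_reversion hP hM n.+1.
  by rewrite eQ coefD coefXnM ltnn subnn coef1 add0r.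
have [Q' eQ'] := reversion_perturb a P0 M0 (ltn0Sn n).
exists (M + a *: 'X^(n.+1)); split.
- by apply: gradedD => //; exact: gradedZXn.
- by rewrite coefD M0 coefZ coefXn mulr0 addr0.
- rewrite (leq_trans (size_polyD _ _))// geq_max (leq_trans sM)//=.
  by rewrite (leq_trans (size_scale_leq _ _))// size_polyXn.
have [q eq] : exists q, Q = (Q`_0)%:P + 'X * q.
  elim/poly_ind: (Q) => [|q b _]; first by exists 0; rewrite coef0 mulr0 addr0.
  by exists q; rewrite coefD coefMX coefC /= add0r addrC mulrC.
exists (q + Q'); rewrite eQ' eQ.
have -> : a *+ 2 = - Q`_0.
  by rewrite /a scaleNr mulNrn scalerMnl -mulr_natr mulVf ?pnatr_eq0// scale1r.
by move: (Q`_0) eq => b ->; rewrite -mul_polyC polyCN !exprSr; ring.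
Qed.

End Graded.

(** * Taylor expansions at 0 *)

Section Expansions.
Variable R : realType.
Implicit Types (f g : R -> R) (p q : {poly R}).

(** This is f(s) = p(s) + o(s^n). The punctured limit ignores the value of [f] at 0, as suits
    quotients by powers of s. The degree of [p] is not bounded, so products need no truncation. *)
Definition expands n f p := (f s - p.[s]) / s ^+ n @[s --> 0^'] --> (0 : R).

Lemma near0_neq0 : \forall s \near (0 : R)^', s != 0.
Proof. exact: nbhs_dnbhs_neq. Qed.

Lemma near_eq_cvg_dnbhs0 f g (l : R) : (\forall s \near 0^', f s = g s) ->
  f s @[s --> 0^'] --> l -> g s @[s --> 0^'] --> l.
Proof.
move=> fg; apply: cvg_trans; apply: near_eq_cvg.
by near=> s; rewrite (near fg s).
Unshelve. all: by end_near. Qed.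

Lemma cvgD0 f g (a b : R) : f s @[s --> 0^'] --> a -> g s @[s --> 0^'] --> b ->
  f s + g s @[s --> 0^'] --> a + b.
Proof. exact: cvgD. Qed.

Lemma cvgM0 f g (a b : R) : f s @[s --> 0^'] --> a -> g s @[s --> 0^'] --> b ->
  f s * g s @[s --> 0^'] --> a * b.
Proof. exact: cvgM. Qed.

Lemma expands_near n f g p : (\forall s \near 0^', f s = g s) ->
  expands n f p -> expands n g p.
Proof.
move=> fg; rewrite /expands; apply: near_eq_cvg_dnbhs0.
by near=> s; rewrite (near fg s).
Unshelve. all: by end_near. Qed.

Lemma cvg_horner_dnbhs (p : {poly R}) : horner p s @[s --> 0^'] --> p.[0].
Proof. by apply: cvg_within_filter; exact: continuous_horner. Qed.

Lemma expands_cvg n f p : expands n f p -> f s @[s --> 0^'] --> p.[0].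
Proof.
rewrite /expands => h.
have hX : s ^+ n @[s --> (0:R)^'] --> (0:R) ^+ n.
  rewrite -(hornerXn 0 n); under eq_cvg do rewrite -hornerXn.
  exact: cvg_horner_dnbhs.
have := cvgD0 (cvgM0 h hX) (@cvg_horner_dnbhs p).
rewrite mul0r add0r; move=> hh; apply: (near_eq_cvg_dnbhs0 _ hh); near=> s.
have s0 : s != 0 by near: s; exact: near0_neq0.
by rewrite /= divfK ?expf_neq0// subrK.
Unshelve. all: by end_near. Qed.

Lemma expands_horner n p : expands n (horner p) p.
Proof.
by rewrite /expands; under eq_cvg do rewrite subrr mul0r; exact: cvg_cst.
Qed.

Lemma expandsD n f g p q : expands n f p -> expands n g q ->
  expands n (fun s => f s + g s) (p + q).
Proof.
rewrite /expands => hf hg; have := cvgD0 hf hg; rewrite addr0.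
move=> hh; apply: (near_eq_cvg_dnbhs0 _ hh); near=> s.
by rewrite hornerD -mulrDl; congr (_ / _); ring.
Unshelve. all: by end_near. Qed.

Lemma expandsM n f g p q : expands n f p -> expands n g q ->
  expands n (fun s => f s * g s) (p * q).
Proof.
move=> hf hg; rewrite /expands.
have := cvgD0 (cvgM0 hf (expands_cvg hg)) (cvgM0 (@cvg_horner_dnbhs p) hg).
rewrite mul0r mulr0 addr0 => hh; apply: (near_eq_cvg_dnbhs0 _ hh); near=> s.
by rewrite /= hornerM; ring.
Unshelve. all: by end_near. Qed.

Lemma expandsB n f g p q : expands n f p -> expands n g q ->
  expands n (fun s => f s - g s) (p - q).
Proof.
move=> hf hg; rewrite -[- q]mulN1r -[-1]/(- 1%:P) -polyCN.
have := expandsD hf (expandsM (expands_horner n (-1)%:P) hg).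
by apply: expands_near; near=> s; rewrite hornerC mulN1r.
Unshelve. all: by end_near. Qed.

Lemma expandsX n f p k : expands n f p ->
  expands n (fun s => f s ^+ k) (p ^+ k).
Proof.
move=> hf; elim: k => [|k IH].
  by have := expands_horner n 1; apply: expands_near; near=> s; rewrite hornerE.
rewrite exprS; have := expandsM hf IH.
by apply: expands_near; near=> s; rewrite exprS.
Unshelve. all: by end_near. Qed.

Lemma expands_mulX n f p : expands n f p ->
  expands n.+1 (fun s => s * f s) ('X * p).
Proof.
rewrite /expands; move=> hh; apply: (near_eq_cvg_dnbhs0 _ hh); near=> s.
have s0 : s != 0 by near: s; exact: near0_neq0.
rewrite hornerM hornerX -mulrBr exprS -mulf_div divff// mul1r//.
Unshelve. all: by end_near. Qed.

Lemma expands_divX n f p : expands n.+1 f ('X * p) ->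
  expands n (fun s => f s / s) p.
Proof.
rewrite /expands; move=> hh; apply: (near_eq_cvg_dnbhs0 _ hh); near=> s.
have s0 : s != 0 by near: s; exact: near0_neq0.
by rewrite hornerM hornerX exprS; field; rewrite s0 expf_neq0.
Unshelve. all: by end_near. Qed.

Lemma expands_le n f p : expands n f p <-> forall e, 0 < e ->
  \forall s \near 0^', `|f s - p.[s]| <= e * `|s| ^+ n.
Proof.
split=> [/cvgrPdist_le h e e0|h].
  have {}h := h e e0; near=> s.
  have s0 : s != 0 by near: s; exact: near0_neq0.
  have : `|0 - (f s - p.[s]) / s ^+ n| <= e by near: s.
  rewrite sub0r normrN normrM normfV normrX.
  by rewrite ler_pdivrMr// exprn_gt0 // normr_gt0.
apply/cvgrPdist_le => e e0; have {}h := h e e0; near=> s.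
have s0 : s != 0 by near: s; exact: near0_neq0.
have : `|f s - p.[s]| <= e * `|s| ^+ n by near: s.
rewrite sub0r normrN normrM normfV normrX.
by rewrite ler_pdivrMr// exprn_gt0 // normr_gt0.
Unshelve. all: by end_near. Qed.

(** The mean value theorem for endpoints in either order, so that it applies between 0 and s for
    both signs of s. *)
Lemma is_derive_mean (f df : R -> R) (s t : R) :
  (forall x, Num.min s t <= x <= Num.max s t -> is_derive x 1 f (df x)) ->
  exists2 x, Num.min s t <= x <= Num.max s t & f t - f s = df x * (t - s).
Proof.
wlog st : s t / s <= t => [H|].
  case/orP: (le_total s t) => [st|ts] h; first by apply: H.
  have [|x hx e] := H _ _ ts; first by move=> x; rewrite minC maxC; exact: h.
  by exists x; [rewrite minC maxC|rewrite -opprB e -mulrN opprB].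
rewrite (min_idPl st) (max_idPr st) => h.
have [x] : exists2 x, x \in `[s, t]%R & f t - f s = df x * (t - s).
  apply: MVT_segment => // [x|].
    by rewrite in_itv/= => /andP[a b]; apply: h; rewrite !ltW.
  apply: derivable_within_continuous => x; rewrite in_itv/= => /h []//.
by rewrite in_itv/= => hx; exists x.
Qed.

(** The mean value theorem for [f - p] between 0 and s bounds the error by e |x|^n |s| for some x
    with |x| <= |s|. *)
Lemma expands_primitive n f (df : R -> R) p :
  (\forall s \near (0:R), is_derive (s : R) 1 f (df s)) -> f 0 = p.[0] ->
  df 0 = p^`().[0] ->
  expands n df p^`() -> expands n.+1 f p.
Proof.
move=> hf f0 df0 /expands_le h; apply/expands_le => e e0.
(* The intermediate point may be 0, which [expands] leaves out; there the bound comes from [df0]. *)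
have {}h : \forall s \near (0:R), `|df s - p^`().[s]| <= e * `|s| ^+ n.
  have := h e e0; rewrite near_withinE; apply: filterS => s.
  have [->|s0] := eqVneq s 0; last exact.
  by rewrite df0 subrr !normr0 mulr_ge0 // ?exprn_ge0 // ltW.
have /nbhs_ballP[d /= d0 hd] : \forall s \near (0:R), 
  is_derive (s : R) 1 f (df s) /\ `|df s - p^`().[s]| <= e * `|s| ^+ n.
  exact: filterI.
near=> s.
have sd : `|s| < d by near: s; apply: dnbhs0_lt.
have inball x : Num.min 0 s <= x <= Num.max 0 s -> `|x| <= `|s|.
  case: (leP 0 s) => hs /andP[h1 h2].
    by rewrite !ger0_norm.
  by rewrite !ler0_norm ?lerN2// ltW.
have [|x hx] := @is_derive_mean
    (fun x => f x - p.[x]) (fun x => df x - p^`().[x]) 0 s.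
  move=> x /inball hx; have [] := hd x.
    by rewrite /ball/= sub0r normrN (le_lt_trans hx).
  move=> h1 _; apply: is_deriveB.
rewrite f0 subrr !subr0 => ->; rewrite normrM exprSr mulrA ler_wpM2r//.
have [|_] := hd x.
  by rewrite /ball/= sub0r normrN (le_lt_trans (inball _ hx)).
move=> /le_trans; apply; apply: ler_wpM2l; first exact: ltW.
by apply: lerXn2r; rewrite ?nnegrE ?normr_ge0 //; exact: inball.
Unshelve. all: by end_near. Qed.

(** Peano's form of Taylor's formula, by induction on n: the derivative of the Taylor polynomial of
    [f] is the Taylor polynomial of the derivative of [f], and [expands_primitive] integrates. *)
Lemma expands_taylor n f :
  (forall j, (j < n)%N ->
    \forall s \near (0:R), derivable f^`(j)%classic (s : R) 1) ->
  {for 0, continuous f^`(n)%classic} ->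
  expands n f (\poly_(j < n.+1) (f^`(j)%classic 0 / j`!%:R)).
Proof.
elim: n f => [|n IH] f hd hc.
  have hf : f s @[s --> 0^'] --> f 0 by apply: cvg_within_filter; exact: hc.
  have hg : (fun=> - f 0) s @[s --> (0:R)^'] --> - f 0 by exact: cvg_cst.
  have := cvgD0 hf hg; rewrite subrr.
  apply: near_eq_cvg_dnbhs0; near=> s.
  by rewrite horner_poly big_ord1 !expr0 mulr1 fact0 !divr1.
have e : ((\poly_(j < n.+2) (f^`(j)%classic 0 / j`!%:R))^`())%R =
   \poly_(j < n.+1) (f^`()%classic^`(j)%classic 0 / j`!%:R).
  apply/polyP => k; rewrite coef_deriv !coef_poly ltnS.
  case: ifP => // _; last by rewrite mul0rn.
  rewrite -derive1Sn factS natrM -mulr_natr; field.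
  by rewrite pnatr_eq0 -lt0n fact_gt0 addrC natr1 pnatr_eq0.
apply: (@expands_primitive n f f^`()%classic).
- have := hd 0%N isT; apply: filterS => s h.
  by rewrite derive1E; exact: derivableP.
- rewrite horner_poly big_ord_recl big1 ?addr0 ?expr0 ?mulr1 ?divr1// => i _.
  by rewrite expr0n mulr0.
- rewrite e horner_poly big_ord_recl big1 ?addr0 ?expr0 ?mulr1 ?divr1// => i _.
  by rewrite expr0n mulr0.
- rewrite e; apply: IH => [j jn|]; first by rewrite -derive1Sn; exact: hd.
  by rewrite -derive1Sn.
Unshelve. all: by end_near. Qed.

End Expansions.

(** * Sublevel sets *)

Section Sublevel.
Variable R : realType.
Implicit Types (F dF : R -> R) (P M : {poly R}).

(** The limit is taken in the punctured neighbourhood, so that punctured expansions can be composed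
    with x M(x). *)
Lemma cvg_mulX_dnbhs0 M : M`_0 != 0 -> x * M.[x] @[x --> 0^'] --> (0 : R)^'.
Proof.
move=> M0.
have hM := @cvg_horner_dnbhs R M; have hX := @cvg_horner_dnbhs R 'X.
have h : x * M.[x] @[x --> 0^'] --> (0 : R).
  have := cvgM0 hX hM; rewrite hornerX mul0r; apply: near_eq_cvg_dnbhs0.
  by near=> x; rewrite hornerX.
move=> A /= [e /= e0 hA]; have := h _ (nbhsx_ballx 0 _ e0).
rewrite !near_simpl => hb; near=> x; apply: hA; first by near: x.
have x0 : x != 0 by near: x; exact: near0_neq0.
rewrite mulf_neq0//; near: x.
apply: (cvgr_neq0 M.[0]) => //.
by rewrite horner_coef0.
Unshelve. all: by end_near. Qed.

Lemma expands_reversion n F P M : M`_0 != 0 ->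
  expands n (fun s => F s / s ^+ 2) P ->
  expands n (fun x => F (x * M.[x]) / x ^+ 2) (reversion P M).
Proof.
move=> M0 h.
(* With t = x M(x), dividing by x^2 and x^n instead of t^2 and t^n costs the factor M(x)^(n+2),
   which stays bounded. *)
have hM := @cvg_horner_dnbhs R (M ^+ n.+2).
have hc : (fun x =>
    (F (x * M.[x]) / (x * M.[x]) ^+ 2 - P.[x * M.[x]]) / (x * M.[x]) ^+ n) x
    @[x --> 0^'] --> (0 : R).
  exact: (cvg_comp _ _ (cvg_mulX_dnbhs0 M0) h).
have := cvgM0 hc hM; rewrite mul0r; apply: near_eq_cvg_dnbhs0; near=> x.
have x0 : x != 0 by near: x; exact: near0_neq0.
have : M.[x] != 0.
  near: x; apply: (cvgr_neq0 M.[0]); first exact: cvg_horner_dnbhs.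
  by rewrite horner_coef0.
rewrite horner_exp /reversion [((P \Po _) * _).[x]]hornerM horner_comp.
rewrite hornerM hornerX horner_exp.
move: M.[x] => m m0; rewrite !exprMn !exprS; field.
by rewrite ?x0 ?m0 ?expf_neq0.
Unshelve. all: by end_near. Qed.

(** By [reversion_perturb], F at the perturbed point is x^2 (1 + 2 e x^n + o(x^n)). As n is even,
    the difference with x^2 has the sign of e on both sides of 0. *)
Lemma reversion_sign n F P M Q e : (0 < n)%N -> ~~ odd n -> e != 0 ->
  P`_0 = 1 -> M`_0 = 1 -> expands n (fun s => F s / s ^+ 2) P ->
  reversion P M = 1 + 'X^(n.+1) * Q ->
  \forall x \near 0^', 0 < e * (F (x * (M + e *: 'X^n).[x]) - x ^+ 2).
Proof.
move=> n0 nodd e0 P0 M0 hF hQ.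
have [Q' eQ'] := reversion_perturb e P0 M0 n0.
have M'0 : (M + e *: 'X^n)`_0 != 0.
  by rewrite coefD M0 coefZ coefXn (ltn_eqF n0) mulr0 addr0 oner_eq0.
have h := expands_reversion M'0 hF; rewrite eQ' hQ in h.
have hr := @cvg_horner_dnbhs R ((e *+ 2)%:P + 'X * (Q + Q')).
have := cvgD0 h hr.
rewrite add0r hornerD hornerC hornerM hornerX mul0r addr0 => hl.
have : 0 < e * (e *+ 2) by rewrite mulrnAr -expr2 pmulrn_lgt0 // exprn_even_gt0.
move=> he; have {}hl := cvgM0 (@cvg_horner_dnbhs R e%:P) hl.
rewrite hornerC in hl.
near=> x.
have x0 : x != 0 by near: x; exact: near0_neq0.
have : 0 < e%:P.[x] * ((F (x * (M + e *: 'X^n).[x]) / x ^+ 2 -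
   (1 + 'X^(n.+1) * Q + (e *+ 2) *: 'X^n + 'X^(n.+1) * Q').[x]) / x ^+ n +
      ((e *+ 2)%:P + 'X * (Q + Q')).[x]).
  by near: x; apply: (cvgr_gt _ hl).
rewrite !(hornerXn, hornerX, hornerC, hornerD, hornerZ, hornerM) => hp.
rewrite -(pmulr_lgt0 _ (_ : 0 < (x ^+ 2 * x ^+ n)^-1)); last first.
  by rewrite invr_gt0 mulr_gt0 // exprn_even_gt0 // x0 orbT.
apply: (lt_le_trans hp); rewrite le_eqVlt; apply/orP; left; apply/eqP.
by rewrite [x ^+ n.+1]exprS; field; rewrite ?x0 ?expf_neq0.
Unshelve. all: by end_near. Qed.

(** The sign condition makes F increase away from 0 on each side; [0 <= s * t] keeps both points on
    one side and allows [s] to be 0. *)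
Lemma radial_increasing F dF (d : R) :
  (forall c : R, `|c| < d -> is_derive (c : R) 1 F (dF c)) ->
  (forall c : R, c != 0 -> `|c| < d -> 0 < dF c * c) ->
  forall s t, `|s| < `|t| -> `|t| < d -> 0 <= s * t -> F s < F t.
Proof.
move=> hF hd s t st td; rewrite le_eqVlt eq_sym mulf_eq0 => st0.
have [t0|t0|t0] := ltgtP t 0;
  last by move: st; rewrite t0 normr0 ltNge normr_ge0.
- have s0 : s <= 0.
    by case/orP: st0 => [/orP[/eqP->//|/eqP]|]; [lra|rewrite nmulr_lgt0 // => /ltW].
  move: st td; rewrite !ler0_norm ?(ltW t0)// ltrN2 => ts td.
  have [||c] := @MVT R F dF _ _ ts.
  + move=> c; rewrite in_itv/= => /andP[a b]; apply: hF.
    by rewrite ler0_norm; lra.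
  + apply: derivable_within_continuous => c; rewrite in_itv/= => /andP[a b].
    have [//] : is_derive (c : R) 1 F (dF c).
    by apply: hF; rewrite ler0_norm; lra.
  rewrite in_itv/= => /andP[a b] e; rewrite -subr_lt0 e pmulr_llt0 ?subr_gt0//.
  by rewrite -(nmulr_lgt0 _ (_ : c < 0)) ?hd ?ler0_norm; lra.
- have s0 : 0 <= s.
    by case/orP: st0 => [/orP[/eqP->//|/eqP]|]; [lra|rewrite pmulr_lgt0 // => /ltW].
  move: st td; rewrite !ger0_norm ?(ltW t0)// => ts td.
  have [||c] := @MVT R F dF _ _ ts.
  + move=> c; rewrite in_itv/= => /andP[a b]; apply: hF.
    by rewrite ger0_norm; lra.
  + apply: derivable_within_continuous => c; rewrite in_itv/= => /andP[a b].
    have [//] : is_derive (c : R) 1 F (dF c).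
    by apply: hF; rewrite ger0_norm; lra.
  rewrite in_itv/= => /andP[a b] e; rewrite -subr_gt0 e pmulr_lgt0 ?subr_gt0//.
  by rewrite -(pmulr_lgt0 _ (_ : 0 < c)) ?hd ?ger0_norm; lra.
Qed.

Lemma measure_near_itv (J : set R) (a b a' b' : R) : measurable J ->
  a <= b -> a' <= b' -> `[a, b]%classic `<=` J -> J `<=` `[a', b']%classic ->
  lebesgue_measure J \is a fin_num /\
  b - a <= fine (lebesgue_measure J) <= b' - a'.
Proof.
move=> mJ ab ab' h1 h2.
have e (x y : R) : x <= y ->
    lebesgue_measure (`[x, y]%classic : set R) = (y - x)%:E.
  rewrite le_eqVlt => /orP[/eqP->|xy]; rewrite lebesgue_measure_itv /= lte_fin.
    by rewrite ltxx subrr.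
  by rewrite xy EFinB.
have l1 : ((b - a)%:E <= lebesgue_measure J)%E.
  by rewrite -e//; apply: le_measure => //; rewrite inE //; exact: measurable_itv.
have l2 : (lebesgue_measure J <= (b' - a')%:E)%E.
  by rewrite -e//; apply: le_measure => //; rewrite inE //; exact: measurable_itv.
have f : lebesgue_measure J \is a fin_num.
  rewrite fin_numE; apply/andP; split; apply/eqP => h.
    by move: l1; rewrite h.
  by move: l2; rewrite h.
by split => //; rewrite -!lee_fin fineK// l1 l2.
Qed.

(** The radius [d] is fixed before the tolerance [e]: it only has to ensure radial monotonicity.
    Monotonicity then reduces the comparison of sets to the sign of F - x^2 at four points. *)
Lemma sublevel_measure n F dF P M Q : (0 < n)%N -> ~~ odd n ->
  (\forall s \near (0 : R), is_derive (s : R) 1 F (dF s)) ->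
  (\forall s \near 0^', 0 < dF s * s) ->
  expands n (fun s => F s / s ^+ 2) P -> P`_0 = 1 -> M`_0 = 1 ->
  reversion P M = 1 + 'X^(n.+1) * Q ->
  \forall d \near 0^'+,
    (forall y, is_interval [set s | `|s| < d /\ F s <= y]) /\
    forall e, 0 < e -> \forall x \near 0^'+,
      lebesgue_measure [set s | `|s| < d /\ F s <= x ^+ 2] \is a fin_num /\
      `|fine (lebesgue_measure [set s | `|s| < d /\ F s <= x ^+ 2])
        - x * (M.[x] + M.[- x])| <= e * x ^+ n.+1.
Proof.
move=> n0 nodd hF hdF hG P0 M0 hQ.
near=> d.
have hFd c : `|c| < d -> is_derive (c : R) 1 F (dF c).
  move: c; near: d; rewrite !near_simpl.
  move/nbhs_ballP : hF => [d0 /= d00 hd0].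
  near=> d => c cd; apply: hd0; rewrite /ball/= sub0r normrN (lt_le_trans cd)//.
  by near: d; exact: nbhs_right_le.
have hdFd c : c != 0 -> `|c| < d -> 0 < dF c * c.
  move=> c0; move: c c0; near: d; rewrite !near_simpl.
  have [d0 /= d00 hd0] := hdF.
  near=> d => c c0 cd; apply: hd0 => //.
  rewrite /ball/= sub0r normrN (lt_le_trans cd)//.
  by near: d; exact: nbhs_right_le.
have d0 : 0 < d by near: d; exact: nbhs_right_gt.
have inc := radial_increasing hFd hdFd.
have incw s t : `|s| <= `|t| -> `|t| < d -> 0 <= s * t -> F s <= F t.
  rewrite le_eqVlt => /orP[/eqP e td st|a b c]; last exact/ltW/inc.
  suff -> : s = t by [].
  move/eqP: e; rewrite eqr_norm2 => /orP[/eqP//|/eqP e].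
  move: st; rewrite e mulNr -expr2 oppr_ge0 => h.
  have /eqP := @le_anti _ _ (t ^+ 2) 0 (introT andP (conj h (sqr_ge0 t))).
  by rewrite sqrf_eq0 => /eqP ->; rewrite oppr0.
have intJ y : is_interval [set s | `|s| < d /\ F s <= y].
  move=> a b /= [ad ay] [bd bY] c /andP[ac cb].
  have cd : `|c| < d.
    move: ad bd; rewrite !ltr_norml => /andP[? ?] /andP[? ?].
    by apply/andP; split; lra.
  split => //; have [c0|/ltW c0] := leP 0 c.
    apply: le_trans bY; apply: incw => //.
      by rewrite !ger0_norm // (le_trans c0).
    by rewrite mulr_ge0 // (le_trans c0).
  apply: le_trans ay; apply: incw => //; last first.
    by rewrite mulr_le0 // (le_trans ac).
  by rewrite !ler0_norm ?lerN2 // (le_trans ac).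
split => // e e0.
(* Approximate endpoints of the sublevel set; k = e/2 pushes them outside the set and k = - e/2
   inside, on the right at x and on the left at - x. *)
pose t (k x : R) := x * (M + k *: 'X^n).[x].
have tsmall k : \forall x \near (0 : R)^', `|t k x| < d.
  have hM := @cvg_horner_dnbhs R ('X * (M + k *: 'X^n)).
  rewrite hornerM hornerX mul0r in hM.
  near=> x; rewrite -normrN -sub0r /t.
  suff : `|0 - ('X * (M + k *: 'X^n)).[x]| < d by rewrite hornerM hornerX.
  by near: x; apply: cvgr_dist_lt.
have tpos k : \forall x \near (0 : R)^', 0 < (M + k *: 'X^n).[x].
  apply: (cvgr_gt (M + k *: 'X^n).[0]); first exact: cvg_horner_dnbhs.
  by rewrite horner_coef0 coefD M0 coefZ coefXn (ltn_eqF n0) mulr0 addr0.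
pose good k x := [/\ `|t k x| < d, 0 < (M + k *: 'X^n).[x] &
   0 < k * (F (t k x) - x ^+ 2)].
have hgood k : k != 0 -> \forall x \near (0 : R)^', good k x.
  move=> k0; have := reversion_sign n0 nodd k0 P0 M0 hG hQ.
  move=> h; near=> x; split; near: x => //.
have hgood' k : k != 0 -> \forall x \near (0 : R)^'+, good k x /\ good k (- x).
  move=> /hgood [r /= r0 hr]; near=> x.
  have x0 : 0 < x by near: x; exact: nbhs_right_gt.
  have xr : x < r by near: x; exact: nbhs_right_lt.
  split; apply: hr; rewrite /ball/= ?oppr_eq0 ?gt_eqF//;
    by rewrite sub0r ?opprK ?normrN ger0_norm // ltW.
have e2 : e / 2 != 0 by rewrite mulf_neq0 ?gt_eqF // invr_neq0.
have e2' : - (e / 2) != 0 by rewrite oppr_eq0.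
near=> x.
have x0 : 0 < x by near: x; exact: nbhs_right_gt.
have [[u1 u2 u3] [u4 u5 u6]] : good (e / 2) x /\ good (e / 2) (- x).
  by near: x; exact: hgood'.
have [[l1 l2 l3] [l4 l5 l6]] :
    good (- (e / 2)) x /\ good (- (e / 2)) (- x).
  by near: x; exact: hgood'.
have e20 : 0 < e / 2 by rewrite divr_gt0.
rewrite sqrrN in u6 l6.
have posE y : (0 < e / 2 * (y - x ^+ 2)) = (x ^+ 2 < y).
  by rewrite pmulr_rgt0 // subr_gt0.
have negE y : (0 < - (e / 2) * (y - x ^+ 2)) = (y < x ^+ 2).
  by rewrite mulNr -mulrN opprB pmulr_rgt0 // subr_gt0.
rewrite !posE in u3 u6; rewrite !negE in l3 l6.
have pu : 0 < t (e / 2) x by rewrite mulr_gt0.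
have nu : t (e / 2) (- x) < 0 by rewrite /t mulNr oppr_lt0 mulr_gt0.
have pl : 0 < t (- (e / 2)) x by rewrite mulr_gt0.
have nl : t (- (e / 2)) (- x) < 0 by rewrite /t mulNr oppr_lt0 mulr_gt0.
(* The inner interval has its endpoints at k = - e/2, the outer one at k = e/2. *)
have [|||||f /andP[b1 b2]] := @measure_near_itv
   [set s | `|s| < d /\ F s <= x ^+ 2]
   (t (- (e / 2)) (- x)) (t (- (e / 2)) x) (t (e / 2) (- x)) (t (e / 2) x).
- by apply: is_interval_measurable; exact: intJ.
- by rewrite (le_trans (ltW nl)) // ltW.
- by rewrite (le_trans (ltW nu)) // ltW.
- move=> s /=; rewrite in_itv/= => /andP[s1 s2].
  have [s0|/ltW s0] := leP 0 s.
    have sn : `|s| <= `|t (- (e / 2)) x| by rewrite !ger0_norm // ltW.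
    split; first exact: (le_lt_trans sn).
    by apply/ltW/(le_lt_trans _ l3)/incw => //; rewrite mulr_ge0 // ltW.
  have sn : `|s| <= `|t (- (e / 2)) (- x)| by rewrite !ler0_norm ?lerN2 // ltW.
  split; first exact: (le_lt_trans sn).
  by apply/ltW/(le_lt_trans _ l6)/incw => //; rewrite mulr_le0 // ltW.
- move=> s /= [sd sF]; rewrite in_itv/= !leNgt.
  apply/andP; split; apply/negP => h.
    have s0 : s < 0 by exact: lt_trans nu.
    suff : F (t (e / 2) (- x)) < F s by rewrite ltNge (le_trans sF) // ltW.
    apply: inc => //; last by rewrite mulr_le0 // ltW.
    by rewrite !ltr0_norm // ltrN2.
  have s0 : 0 < s by exact: lt_trans h.
  suff : F (t (e / 2) x) < F s by rewrite ltNge (le_trans sF) // ltW.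
  apply: inc => //; last by rewrite mulr_ge0 // ltW.
  by rewrite !gtr0_norm.
split => //.
(* Since n is even the two corrections add up to 2 k x^(n+1), which is e x^(n+1) in absolute value
   for k = e/2 and k = - e/2. *)
have tB k : t k x - t k (- x) = x * (M.[x] + M.[- x]) + 2 * k * x ^+ n.+1.
  rewrite /t !hornerD !hornerZ !hornerXn exprNn -signr_odd (negbTE nodd).
  by rewrite expr0 exprS; ring.
rewrite !tB in b1 b2; rewrite ler_norml; apply/andP; split; lra.
Unshelve. all: by end_near. Qed.

End Sublevel.

(** * Jets of the projected curve *)

Section LinearDerive.
Context {R : realType} {V W : normedModType R}.
Variable L : {linear V -> W}.
Hypothesis L_continuous : continuous L.
Implicit Types (f : R -> V) (I : set R).

Lemma is_derive_linear f (s : R) : derivable f s 1 ->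
  is_derive s 1 (L \o f) (L ('D_1 f s)).
Proof.
move=> df.
have h : (fun h : R => h^-1 *: ((L \o f) (h *: (1:R) + s) - (L \o f) s)) @ 0^' -->
     L ('D_1 f s).
  rewrite (_ : (fun h : R => _) =
    L \o (fun h : R => h^-1 *: (f (h *: (1:R) + s) - f s))); last first.
    by apply/funext => h; rewrite /= linearZ; congr (_ *: _); exact/esym/linearB.
  by apply: cvg_comp df _; exact: L_continuous.
apply: DeriveDef; first by apply/cvg_ex; exists (L ('D_1 f s)).
exact: (cvg_lim (@norm_hausdorff _ _) h).
Qed.

(** Openness of [I] drives the induction: the identity for one derivative holds near s, so it can be
    differentiated again. *)
Lemma derive1n_linear k I f : open I -> is_Ck_on k I f ->
  forall j, (j <= k)%N -> forall s, I s ->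
  (L \o f)^`(j)%classic s = L (f^`(j)%classic s).
Proof.
move=> oI [df _]; elim=> [//|j IH] jk s Is.
have hD := is_derive_linear (df j s jk Is).
rewrite !derive1nS !derive1E -(@derive_val _ _ _ _ _ _ _ hD).
apply: near_eq_derive; have := open_nbhs_nbhs (conj oI Is).
by apply: filterS => t It; rewrite IH // ltnW.
Qed.

Lemma is_Ck_on_linear k I f : open I -> is_Ck_on k I f -> is_Ck_on k I (L \o f).
Proof.
move=> oI hf; have e := derive1n_linear oI hf; have [df cf] := hf; split.
  move=> j s jk Is; have [+ _] := is_derive_linear (df j s jk Is).
  apply: near_eq_derivable; have := open_nbhs_nbhs (conj oI Is).
  by apply: filterS => t It; rewrite e // ltnW.
move=> s Is; rewrite /prop_for /continuous_at (e k (leqnn k) s Is).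
have h : (L \o f^`(k)%classic) x @[x --> s] --> L (f^`(k)%classic s).
  by apply: cvg_comp (cf s Is) _; exact: L_continuous.
apply: (cvg_trans _ h); apply: near_eq_cvg; have := open_nbhs_nbhs (conj oI Is).
by apply: filterS => t It; rewrite /= e.
Qed.

End LinearDerive.

Section Jets.
Variable R : realType.

Definition jet_g (i j : 'I_6) : jet_poly R :=
  mpolyX R (mnm1 (enum_rank (inl (i, j) : jet_var))).

Definition jet_omega (i j : 'I_6) : jet_poly R :=
  mpolyX R (mnm1 (enum_rank (inr (i, j) : jet_var))).

Lemma jet_eval_g gamma i j : jet_eval gamma (jet_g i j) =
  planar_g (gamma^`(i.+1)%classic 0) (gamma^`(j.+1)%classic 0).
Proof. by rewrite /jet_eval mevalXU enum_rankK. Qed.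

Lemma jet_eval_omega gamma i j : jet_eval gamma (jet_omega i j) =
  planar_omega (gamma^`(i.+1)%classic 0) (gamma^`(j.+1)%classic 0).
Proof. by rewrite /jet_eval mevalXU enum_rankK. Qed.

Lemma jet_var_homogeneous (u : jet_var) :
  weighted_homogeneous (jet_var_weight u)
    (mpolyX R (mnm1 (enum_rank u)) : jet_poly R).
Proof.
rewrite /weighted_homogeneous dhomogX; apply/eqP.
rewrite /= /jet_weight (bigD1 (enum_rank u)) //= mnm1E eqxx mul1n.
rewrite enum_rankK big1 ?addn0//.
by move=> k ku; rewrite mnm1E eq_sym (negbTE ku).
Qed.

(* With gamma(s) - gamma(0) = s A(s), [jet_sqnorm] is the formal expansion of
   |A(s)|^2, and [jet_height] that of t(s) / s, where t is the third coordinate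
   of Sigma(0)^-1 * Sigma(s): its derivative is
   t' = 1 - 2 omega (s A) gamma'. *)
Definition jet_sqnorm : {poly jet_poly R} :=
  \sum_(i < 6) \sum_(j < 6)
    ((i.+1`! * j.+1`!)%:R^-1 *: jet_g i j) *: 'X^(i + j).

Definition jet_height : {poly jet_poly R} :=
  1 - \sum_(i < 6) \sum_(j < 6)
    ((2 / (i.+1`! * j`! * (i + j).+2)%:R) *: jet_omega i j) *: 'X^((i + j).+1).

(** The formal expansion of F(s) / s^2, that is of (t(s) / s)^2 + (s |A(s)|^2)^2. *)
Definition jet_dist : {poly jet_poly R} :=
  jet_height ^+ 2 + ('X * jet_sqnorm) ^+ 2.

(** The variables with indices i+1 and j+1 have weight 2 (i + j + 1). This matches the powers of
    ['X] in [jet_height], and those in [jet_sqnorm] after multiplication by ['X]. *)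
Lemma graded_dist : graded jet_dist.
Proof.
apply: gradedD; apply: gradedX.
  apply: gradedD; first exact: graded1.
  apply: gradedN; apply: graded_sum => i _; apply: graded_sum => j _.
  apply: gradedZXn; apply: dhomogZ.
  have := jet_var_homogeneous (inr (i, j)); rewrite /jet_var_weight.
  by congr weighted_homogeneous; lia.
rewrite mulr_sumr; apply: graded_sum => i _.
rewrite mulr_sumr; apply: graded_sum => j _.
rewrite -scalerAr -exprS; apply: gradedZXn; apply: dhomogZ.
have := jet_var_homogeneous (inl (i, j)); rewrite /jet_var_weight.
by congr weighted_homogeneous; lia.
Qed.

Lemma jet_height0 : jet_height`_0 = 1.
Proof.
rewrite coefB coef1 coef_sum big1 ?subr0// => i _.
by rewrite coef_sum big1// => j _; rewrite coefZ coefXn mulr0.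
Qed.

Lemma jet_dist0 : jet_dist`_0 = 1.
Proof.
by rewrite coefD !expr2 !coef0M jet_height0 mulr1 coefX !mul0r addr0.
Qed.

End Jets.

(** * Expansion of the fourth power of the distance along a curve with coordinates [u], [v], [w] *)

Section KoranyiExpansion.
Variable R : realType.
Implicit Types (f u v w : R -> R).

Definition difference_taylor f : {poly R} :=
  \poly_(i < 6) (f^`(i.+1)%classic 0 / i.+1`!%:R).

Definition derive_taylor f : {poly R} :=
  \poly_(i < 6) (f^`(i.+1)%classic 0 / i`!%:R).

Lemma expands_difference I f : open I -> I 0 -> is_Ck_on 6 I f ->
  expands 5 (fun s => (f s - f 0) / s) (difference_taylor f).
Proof.
move=> oI I0 [df cf]; apply: expands_divX.
have hf : expands 6 f (\poly_(j < 7) (f^`(j)%classic 0 / j`!%:R)).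
  apply: expands_taylor; last exact: cf.
  move=> j j6; apply: filterS (open_nbhs_nbhs (conj oI I0)) => s; exact: df.
have := expandsB hf (expands_horner 6 (f 0)%:P).
rewrite (_ : _ - (f 0)%:P = 'X * difference_taylor f).
  by apply: expands_near; near=> s; rewrite hornerC.
apply/polyP => k; rewrite coefB coefC coefXM !coef_poly.
case: k => [|k] /=; first by rewrite fact0 divr1 subrr.
by rewrite ltnS subr0.
Unshelve. all: by end_near. Qed.

Lemma expands_derive I f : open I -> I 0 -> is_Ck_on 6 I f ->
  expands 5 f^`()%classic (derive_taylor f).
Proof.
move=> oI I0 [df cf].
rewrite (_ : derive_taylor f =
  \poly_(j < 6) (f^`()%classic^`(j)%classic 0 / j`!%:R)).
  apply: expands_taylor; last by rewrite -derive1Sn; exact: cf.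
  move=> j j5; apply: filterS (open_nbhs_nbhs (conj oI I0)) => s.
  by rewrite -derive1Sn; exact: df.
by apply/polyP => k; rewrite !coef_poly; case: ifP => //; rewrite derive1Sn.
Qed.

Variables (I : set R) (u v w : R -> R).
Hypotheses (oI : open I) (I0 : I 0).
Hypotheses (hu : is_Ck_on 6 I u) (hv : is_Ck_on 6 I v) (hw : is_Ck_on 6 I w).
Hypothesis arclength : forall s, I s ->
  w^`()%classic s + 2 * u s * v^`()%classic s - 2 * v s * u^`()%classic s = 1.

Let du s := u s - u 0.
Let dv s := v s - v 0.
Let du' s := du s / s.
Let dv' s := dv s / s.

(** The third coordinate of Sigma(0)^-1 * Sigma(s). *)
Definition height s := w s - w 0 + 2 * u 0 * v s - 2 * v 0 * u s.

Definition dist4 s :=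
  ((u s - u 0) ^+ 2 + (v s - v 0) ^+ 2) ^+ 2 + height s ^+ 2.

(** The difference quotients make a factor s explicit, which raises the order of the expansion by
    one. *)
Let dheight s :=
  1 - 2 * (s * (du' s * v^`()%classic s - dv' s * u^`()%classic s)).

Definition ddist4 s :=
  4 * (du s ^+ 2 + dv s ^+ 2) *
    (du s * u^`()%classic s + dv s * v^`()%classic s) +
  2 * height s * dheight s.

Let nearI : \forall s \near (0 : R), I s.
Proof. exact: open_nbhs_nbhs. Qed.

Let sdu s : s * du' s = du s.
Proof.
have [->|s0] := eqVneq s 0; last by rewrite mulrC divfK.
by rewrite mul0r /du subrr.
Qed.

Let sdv s : s * dv' s = dv s.
Proof.
have [->|s0] := eqVneq s 0; last by rewrite mulrC divfK.
by rewrite mul0r /dv subrr.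
Qed.

Let dheightE s :
  dheight s = 1 - 2 * (du s * v^`()%classic s - dv s * u^`()%classic s).
Proof.
rewrite /dheight; move: (sdu s) (sdv s); move: (du' s) (dv' s) (du s) (dv s).
by move=> a b _ _ <- <-; ring.
Qed.

Let dheight0 : dheight 0 = 1.
Proof. by rewrite /dheight mul0r mulr0 subr0. Qed.

Let is_derive_Ck f s : is_Ck_on 6 I f -> I s ->
  is_derive s 1 f (f^`()%classic s).
Proof.
by move=> [df _] Is; rewrite derive1E; apply: derivableP; exact: (df 0%N).
Qed.

(** The arclength condition eliminates the derivative of [w], so that only the projected curve
    remains. *)
Let is_derive_height s : I s -> is_derive s 1 height (dheight s).
Proof.
move=> Is.
have ? := is_derive_Ck hu Is; have ? := is_derive_Ck hv Is.
have ? := is_derive_Ck hw Is.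
rewrite /height; apply: is_derive_eq.
by have := arclength Is; rewrite dheightE /du /dv /GRing.scale /=; lra.
Qed.

Lemma is_derive_dist4 s : I s -> is_derive s 1 dist4 (ddist4 s).
Proof.
move=> Is.
have ? := is_derive_Ck hu Is; have ? := is_derive_Ck hv Is.
have ? := is_derive_height Is.
rewrite /dist4; apply: is_derive_eq.
by rewrite /ddist4 /du /dv /GRing.scale /=; ring.
Qed.

Let U := difference_taylor u.
Let V := difference_taylor v.
Let U' := derive_taylor u.
Let V' := derive_taylor v.

Let expands_U : expands 5 du' U. Proof. exact: expands_difference hu. Qed.
Let expands_V : expands 5 dv' V. Proof. exact: expands_difference hv. Qed.
Let expands_U' : expands 5 u^`()%classic U'.
Proof. exact: expands_derive hu. Qed.
Let expands_V' : expands 5 v^`()%classic V'.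
Proof. exact: expands_derive hv. Qed.

Let expands_dheight : expands 6 dheight (1 - 2%:P * ('X * (U * V' - V * U'))).
Proof.
have := expandsB (expands_horner 6 1) (expandsM (expands_horner 6 2%:P)
  (expands_mulX (expandsB (expandsM expands_U expands_V')
                          (expandsM expands_V expands_U')))).
by apply: expands_near; near=> s; rewrite !hornerC.
Unshelve. all: by end_near. Qed.

Let horner_mulX0 (p : {poly R}) : ('X * p).[0] = 0.
Proof. by rewrite hornerM hornerX mul0r. Qed.

Let horner_area0 (p : {poly R}) : (1 - 2%:P * ('X * p)).[0] = 1.
Proof. by rewrite hornerD hornerN mulrCA horner_mulX0 oppr0 addr0 hornerC. Qed.

Section Height.
Variable T : {poly R}.
Hypothesis dT : (('X * T)^`() = 1 - 2%:P * ('X * (U * V' - V * U')))%R.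

(** [T] is specified through the derivative of ['X * T], so the expansion follows by integrating
    that of [dheight] and dividing by s. *)
Let expands_height : expands 6 (fun s => height s / s) T.
Proof.
apply: expands_divX; apply: (@expands_primitive _ _ _ dheight).
- by apply: filterS nearI => s; exact: is_derive_height.
- by rewrite /height hornerM hornerX mul0r; ring.
- by rewrite dheight0 dT horner_area0.
- by rewrite dT; exact: expands_dheight.
Qed.

(** Six derivatives expand the difference quotients and first derivatives to order 5 only. Order 6
    is reached because each such expansion enters multiplied by s, both in [dheight] and in s
    |A(s)|^2. *)
Lemma expands_dist4 : expands 6 (fun s => dist4 s / s ^+ 2)
  (T ^+ 2 + ('X * (U ^+ 2 + V ^+ 2)) ^+ 2).
Proof.
have := expandsD (expandsX 2 expands_height)
  (expandsX 2 (expands_mulX (expandsD (expandsX 2 expands_U)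
                                      (expandsX 2 expands_V)))).
apply: expands_near; near=> s.
have s0 : s != 0 by near: s; exact: near0_neq0.
rewrite /dist4 /du' /dv' /du /dv.
by move: (u s - u 0) (v s - v 0) (height s) => a b c; field.
Unshelve. all: by end_near. Qed.

Hypothesis T0 : T`_0 = 1.

(** Divided by 2 s^2, the product tends to 1: the planar part vanishes at 0, while [height s / s]
    and [dheight s] both tend to 1. *)
Lemma ddist4_sign : \forall s \near 0^', 0 < ddist4 s * s.
Proof.
have h1 := expandsM
  (expands_mulX (expandsD (expandsX 2 expands_U) (expandsX 2 expands_V)))
  (expands_mulX (expandsD (expandsM expands_U expands_U')
                          (expandsM expands_V expands_V'))).
(* The planar term is taken twice because it has coefficient 4 in [ddist4], against 2 for the height
   term. *)
have := expandsD (expandsD h1 h1) (expandsM expands_height expands_dheight).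
move/expands_cvg; set l := _.[0] => h.
have l1 : l = 1.
  rewrite /l -!mulrA !hornerD !horner_mulX0 hornerM horner_area0.
  by rewrite horner_coef0 T0 !add0r mulr1.
near=> s.
have s0 : s != 0 by near: s; exact: near0_neq0.
have : 0 < s * (du' s ^+ 2 + dv' s ^+ 2) *
     (s * (du' s * u^`()%classic s + dv' s * v^`()%classic s)) +
   s * (du' s ^+ 2 + dv' s ^+ 2) *
     (s * (du' s * u^`()%classic s + dv' s * v^`()%classic s)) +
   height s / s * dheight s.
  by near: s; apply: (cvgr_gt _ h); rewrite l1.
set y := (X in 0 < X) => y0.
have -> : ddist4 s * s = 2 * s ^+ 2 * y.
  rewrite /y /ddist4 -!sdu -!sdv.
  by move: (du' s) (dv' s) (dheight s) (height s) => a b c d; field.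
by rewrite mulr_gt0 // mulr_gt0 // exprn_even_gt0.
Unshelve. all: by end_near. Qed.

End Height.

End KoranyiExpansion.

(** * Evaluation of the formal expansions at the jet of a curve *)

Section JetEvaluation.
Variables (R : realType) (gamma : R -> R * R) (u v : R -> R).
Hypothesis gammaE : forall i, (i < 6)%N ->
  gamma^`(i.+1)%classic 0 = (u^`(i.+1)%classic 0, v^`(i.+1)%classic 0).

Definition jet_rmorphism : {rmorphism jet_poly R -> R} :=
  meval (fun k => jet_value gamma (enum_val k)).

Local Notation U := (difference_taylor u).
Local Notation V := (difference_taylor v).
Local Notation U' := (derive_taylor u).
Local Notation V' := (derive_taylor v).

Let factR_neq0 k : (k`!%:R : R) != 0.
Proof. by rewrite pnatr_eq0 -lt0n fact_gt0. Qed.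

Let poly_mul6 (a b : nat -> R) :
  (\poly_(i < 6) a i) * (\poly_(j < 6) b j) =
  \sum_(i < 6) \sum_(j < 6) (a i * b j) *: 'X^(i + j).
Proof.
rewrite !poly_def big_distrlr; apply: eq_bigr => i _; apply: eq_bigr => j _.
by rewrite /= -scalerAl -scalerAr scalerA -exprD.
Qed.

Let sum_sqr_poly (a b : nat -> R) :
  (\poly_(i < 6) a i) ^+ 2 + (\poly_(i < 6) b i) ^+ 2 =
  \sum_(i < 6) \sum_(j < 6) (a i * a j + b i * b j) *: 'X^(i + j).
Proof.
rewrite !expr2 !poly_mul6 -big_split; apply: eq_bigr => i _.
by rewrite -big_split; apply: eq_bigr => j _; rewrite scalerDl.
Qed.

Let det_poly (a b c d : nat -> R) :
  (\poly_(i < 6) a i) * (\poly_(j < 6) d j) -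
    (\poly_(i < 6) b i) * (\poly_(j < 6) c j) =
  \sum_(i < 6) \sum_(j < 6) (a i * d j - b i * c j) *: 'X^(i + j).
Proof.
rewrite !poly_mul6 -sumrB; apply: eq_bigr => i _.
by rewrite -sumrB; apply: eq_bigr => j _; rewrite scalerBl.
Qed.

(** Adding the products of Taylor coefficients of [u] and of [v] with the same pair of indices
    yields the scalar products of derivatives of [gamma]. *)
Lemma map_jet_sqnorm : map_poly jet_rmorphism (jet_sqnorm R) = U ^+ 2 + V ^+ 2.
Proof.
rewrite [RHS]sum_sqr_poly rmorph_sum; apply: eq_bigr => i _.
rewrite rmorph_sum; apply: eq_bigr => j _.
rewrite [LHS]map_polyZ map_polyXn [jet_rmorphism _]mevalZ -/(jet_eval _ _).
rewrite jet_eval_g !gammaE //; congr (_ *: _).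
rewrite /planar_g natrM; move: (factR_neq0 i.+1) (factR_neq0 j.+1).
by move: (i.+1`!%:R) (j.+1`!%:R) => a b a0 b0 /=; field; rewrite a0 b0.
Qed.

(** Differentiating the power i + j + 2 of ['X] cancels the denominator i + j + 2 of [jet_height];
    the antisymmetric products of Taylor coefficients form the omega terms. *)
Lemma map_jet_height_deriv :
  (('X * map_poly jet_rmorphism (jet_height R))^`() =
   1 - 2%:P * ('X * (U * V' - V * U')))%R.
Proof.
rewrite rmorphB rmorph1 mulrBr mulr1 derivB derivX; congr (_ - _).
have -> : U * V' - V * U' = _ := det_poly _ _ _ _.
rewrite rmorph_sum !mulr_sumr [LHS]raddf_sum; apply: eq_bigr => i _.
rewrite rmorph_sum !mulr_sumr [LHS]raddf_sum; apply: eq_bigr => j _.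
set c := 2 / _; set d := (X in 2%:P * ('X * (X *: _))).
rewrite /= map_polyZ map_polyXn /= mevalZ -/(jet_eval _ _) jet_eval_omega.
rewrite -scalerAr -exprS -[in RHS]scalerAr -exprS derivZ derivXn -scaler_nat.
rewrite scalerA mul_polyC scalerA /c /d !gammaE //; congr (_ *: _).
rewrite /planar_omega (natrM _ (i.+1`! * j`!)) (natrM _ i.+1`!).
move: (factR_neq0 i.+1) (factR_neq0 j) (pnatr_eq0 R (i + j).+2).
move: (i.+1`!%:R) (j`!%:R) ((i + j).+2%:R) => a b n a0 b0 n0 /=; field.
by rewrite n0 a0 b0.
Qed.


End JetEvaluation.

(** * Small balls and measure along an embedded curve *)

Section Curves.
Variable R : realType.
Implicit Types (I : set R) (S : R -> R * R * R).

Lemma fst_continuous (V W : normedModType R) : continuous (@fst V W).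
Proof. by move=> x; exact: cvg_fst. Qed.

Lemma snd_continuous (V W : normedModType R) : continuous (@snd V W).
Proof. by move=> x; exact: cvg_snd. Qed.

Lemma koranyi_le (z : R * R * R) r : 0 < r ->
  (koranyi z <= r) =
  ((z.1.1 ^+ 2 + z.1.2 ^+ 2) ^+ 2 + z.2 ^+ 2 <= (r ^+ 2) ^+ 2).
Proof.
move=> r0; rewrite /koranyi -exprM -[(2 * 2)%N]/4%N.
set N := (_ + _); have N0 : 0 <= N by rewrite addr_ge0 // sqr_ge0.
have er : r = (r ^+ 4) `^ 4^-1.
  by rewrite -powR_mulrn ?ltW// -powRrM divff// powRr1// ltW.
rewrite {1}er; apply/idP/idP => h.
  rewrite leNgt; apply/negP => h'; move: h; apply/negP; rewrite -ltNge.
  by apply: gt0_ltr_powR; rewrite ?invr_gt0 ?nnegrE ?exprn_ge0 // ltW.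
by apply: ge0_ler_powR; rewrite ?invr_ge0 ?nnegrE ?exprn_ge0 // ltW.
Qed.

Lemma is_Ck_onW (V : normedModType R) I (f : R -> V) j k : (j < k)%N ->
  is_Ck_on k I f -> is_Ck_on j I f.
Proof.
move=> jk [df cf]; split => [i s ij Is|s Is].
  by apply: df => //; exact: ltn_trans jk.
by apply/differentiable_continuous/derivable1_diffP; exact: df.
Qed.

Lemma is_curveW I S : is_curve 6 I S -> is_curve 1 I S.
Proof.
case=> oI iI CkS rS eS; have C1S := @is_Ck_onW _ I S 1 6 isT CkS.
exact: IsCurve oI iI C1S rS eS.
Qed.

Lemma sphericalS2_arclength c I S J : normalizes_S2 c -> is_curve 1 I S ->
  nonhorizontal I S -> homogeneous_arclength I S ->
  is_interval J -> J `<=` I -> sphericalS2 c (S @` J) = lebesgue_measure J.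
Proof.
move=> [_ hc] hS nh ha iJ JI; rewrite (hc _ _ hS nh _ iJ JI).
rewrite -[RHS]mul1e -integral_cst; last exact: is_interval_measurable.
apply: eq_integral => s; rewrite inE => Js.
by rewrite ha ?normr1 //; exact: JI.
Qed.

(** The Korányi bound controls the three coordinates a, b, t of x^-1 * y by r, the last one because
    r^2 <= r. The vertical Euclidean difference is t corrected by 2 x1 b and 2 x2 a, whence the
    constant. *)
Lemma ballH_sub_ball (x y : R * R * R) r e : 0 < r -> r < 1 ->
  r * (1 + 2 * `|x.1.1| + 2 * `|x.1.2|) < e -> dH x y <= r -> ball x e y.
Proof.
case: x y => [[x1 x2] x3] [[y1 y2] y3] r0 r1 /= rK.
rewrite /dH koranyi_le //= => h.
have re : r < e.
  apply: le_lt_trans rK; apply: ler_peMr; first exact: ltW.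
  by rewrite -addrA lerDl addr_ge0 // mulr_ge0.
set a := - x1 + y1 in h; set b := - x2 + y2 in h.
set t := (X in _ + X ^+ 2 <= _) in h.
have sqr_le z : z ^+ 2 <= r ^+ 2 -> `|z| <= r.
  move=> zr; rewrite -(ler_pXn2r (n := 2)) ?nnegrE ?(ltW r0)//.
  by rewrite -normrX ger0_norm ?sqr_ge0.
have ab : a ^+ 2 + b ^+ 2 <= r ^+ 2.
  rewrite -(ler_pXn2r (n := 2)) ?nnegrE ?addr_ge0 ?sqr_ge0//.
  by apply: le_trans h; rewrite lerDl sqr_ge0.
have ha : `|a| <= r by apply/sqr_le/(le_trans _ ab); rewrite lerDl sqr_ge0.
have hb : `|b| <= r by apply/sqr_le/(le_trans _ ab); rewrite lerDr sqr_ge0.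
have ht : `|t| <= r.
  apply: sqr_le; apply: (@le_trans _ _ ((r ^+ 2) ^+ 2)).
    by apply: le_trans h; rewrite lerDr sqr_ge0.
  by rewrite -[leRHS]mulr1 expr2 ler_pM ?sqr_ge0// exprn_ile1 ?ltW.
have hz : x3 - y3 = - t + 2 * x1 * b - 2 * x2 * a by rewrite /t /a /b; ring.
split; first split; rewrite /ball /=.
- by rewrite distrC -[_ - _]addrC (le_lt_trans ha).
- by rewrite distrC -[_ - _]addrC (le_lt_trans hb).
rewrite hz; apply: le_lt_trans rK.
apply: le_trans (ler_normB _ _) _.
rewrite (le_trans (lerD (ler_normD _ _) (lexx _)))//.
rewrite normrN !normrM ger0_norm //.
have := ler_wpM2l (normr_ge0 x1) hb; have := ler_wpM2l (normr_ge0 x2) ha.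
by move: ht; lra.
Qed.

(** Continuity of the inverse parameterization at [S 0] excludes remote arcs that return close to
    that point. *)
Lemma small_ball_parameter I S k d : is_curve k I S -> I 0 -> 0 < d ->
  \forall r \near 0^'+, forall s, I s -> dH (S 0) (S s) <= r -> `|s| < d.
Proof.
move=> [_ _ _ _ [g gS /subspace_continuousP gc]] I0 d0.
have := gc (S 0) (imageP _ I0) => /cvgrPdist_lt /(_ _ d0).
rewrite near_withinE => /nbhs_ballP[e /= e0 he].
pose K := 1 + 2 * `|(S 0).1.1| + 2 * `|(S 0).1.2|.
have K1 : 1 <= K by rewrite /K -addrA lerDl addr_ge0 // mulr_ge0.
have K0 : 0 < K by exact: lt_le_trans K1.
near=> r => s Is.
have r0 : 0 < r by near: r; exact: nbhs_right_gt.
have r1 : r < 1 by near: r; exact: nbhs_right_lt.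
have rK : r < e / K by near: r; apply: nbhs_right_lt; rewrite divr_gt0.
rewrite ltr_pdivlMr // in rK => h.
have := he _ (ballH_sub_ball r0 r1 rK h) (imageP _ Is).
by rewrite /from_subspace !gS // sub0r normrN.
Unshelve. all: by end_near. Qed.

End Curves.

(** * From the formal solution to sublevel sets along a curve *)

Section CurveExpansion.
Variable R : realType.

Lemma at_right0_sqr (A : set R) :
  (\forall x \near 0^'+, A x) -> \forall r \near 0^'+, A (r ^+ 2).
Proof.
move=> [d /= d0 hd]; near=> r.
have r0 : 0 < r by near: r; exact: nbhs_right_gt.
have r1 : r < 1 by near: r; exact: nbhs_right_lt.
have rd : r < d by near: r; exact: nbhs_right_lt.
apply: hd; last by rewrite exprn_gt0.
rewrite /ball /= sub0r normrN ger0_norm ?sqr_ge0 //.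
by apply: lt_trans rd; rewrite expr2 gtr_pMr.
Unshelve. all: by end_near. Qed.

(** Odd powers cancel, even ones double, and the size bound stops the sum at degree 6. *)
Lemma horner_even_part (M : {poly R}) (x : R) : (size M <= 7)%N -> M`_0 = 1 ->
  M.[x] + M.[- x] =
  2 + M`_2 *+ 2 * x ^+ 2 + M`_4 *+ 2 * x ^+ 4 + M`_6 *+ 2 * x ^+ 6.
Proof.
move=> sM M0; rewrite !(horner_coef_wide _ sM) !big_ord_recl !big_ord0 /=.
by rewrite /bump /= M0; ring.
Qed.

Variables (I : set R) (S : R -> R * R * R).
Hypotheses (hS : is_curve 6 I S) (I0 : I 0) (ha : homogeneous_arclength I S).

Let gamma : R -> R * R := piH \o S.
Let u : R -> R := fst \o gamma.
Let v : R -> R := snd \o gamma.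
Let w : R -> R := snd \o S.

Let oI := curve_open hS.
Let CS := curve_Ck hS.
Let Cgamma : is_Ck_on 6 I gamma :=
  is_Ck_on_linear (@fst_continuous _ _ _) oI CS.
Let Cu : is_Ck_on 6 I u := is_Ck_on_linear (@fst_continuous _ _ _) oI Cgamma.
Let Cv : is_Ck_on 6 I v := is_Ck_on_linear (@snd_continuous _ _ _) oI Cgamma.
Let Cw : is_Ck_on 6 I w := is_Ck_on_linear (@snd_continuous _ _ _) oI CS.

Let gammaE s i : I s -> (i <= 6)%N ->
  gamma^`(i)%classic s = (u^`(i)%classic s, v^`(i)%classic s).
Proof.
move=> Is i6; rewrite (derive1n_linear (@fst_continuous _ _ _) oI Cgamma i6 Is).
rewrite (derive1n_linear (@snd_continuous _ _ _) oI Cgamma i6 Is).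
by case: (gamma^`(i)%classic s).
Qed.

Let gamma0E i : (i < 6)%N ->
  gamma^`(i.+1)%classic 0 = (u^`(i.+1)%classic 0, v^`(i.+1)%classic 0).
Proof. by move=> i6; exact: gammaE. Qed.

Let arclengthE s : I s ->
  w^`()%classic s + 2 * u s * v^`()%classic s - 2 * v s * u^`()%classic s = 1.
Proof.
move=> Is; rewrite -[RHS](ha Is) /contact_speed /vartheta.
have e1 : gamma^`()%classic s = (S^`()%classic s).1 :=
  derive1n_linear (@fst_continuous _ _ _) oI CS (isT : (1 <= 6)%N) Is.
have -> : w^`()%classic s = (S^`()%classic s).2 :=
  derive1n_linear (@snd_continuous _ _ _) oI CS (isT : (1 <= 6)%N) Is.
have e2 : gamma^`()%classic s = (u^`()%classic s, v^`()%classic s) :=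
  @gammaE s 1 Is isT.
by rewrite -e1 e2.
Qed.

Lemma dH_curve_le r s : 0 < r ->
  (dH (S 0) (S s) <= r) = (dist4 u v w s <= (r ^+ 2) ^+ 2).
Proof.
move=> r0; rewrite /dH koranyi_le //; congr (_ <= _).
rewrite /dist4 /height /u /v /w /gamma /piH /=.
by congr (_ ^+ 2 + _ ^+ 2); ring.
Qed.

Let jet := jet_rmorphism gamma.

Lemma expands_curve_dist4 :
  expands 6 (fun s => dist4 u v w s / s ^+ 2) (map_poly jet (jet_dist R)).
Proof.
have := expands_dist4 oI I0 Cu Cv Cw arclengthE (map_jet_height_deriv gamma0E).
rewrite -(map_jet_sqnorm gamma0E).
rewrite (_ : map_poly jet (jet_dist R) = map_poly jet (jet_height R) ^+ 2 +
  ('X * map_poly jet (jet_sqnorm R)) ^+ 2) //.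
by rewrite -[in RHS](map_polyX jet) -rmorphM -!rmorphXn -rmorphD.
Qed.

(** Evaluation at the jet is a ring morphism, so it carries the formal equation to the real
    polynomials to which [sublevel_measure] applies. *)
Lemma curve_sublevel_measure (M Q : {poly jet_poly R}) : M`_0 = 1 ->
  reversion (jet_dist R) M = 1 + 'X^7 * Q ->
  let m := map_poly jet M in
  exists d, [/\ 0 < d, forall s, `|s| < d -> I s,
    forall y, is_interval [set s | `|s| < d /\ dist4 u v w s <= y] &
    forall e, 0 < e -> \forall x \near 0^'+,
      lebesgue_measure [set s | `|s| < d /\ dist4 u v w s <= x ^+ 2]
        \is a fin_num /\
      `|fine (lebesgue_measure [set s | `|s| < d /\ dist4 u v w s <= x ^+ 2])
        - x * (m.[x] + m.[- x])| <= e * x ^+ 7].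
Proof.
move=> M0 hQ m.
have hF : \forall s \near (0 : R),
    is_derive (s : R) 1 (dist4 u v w) (ddist4 u v w s).
  apply: filterS (open_nbhs_nbhs (conj oI I0)) => s Is.
  exact: (is_derive_dist4 Cu Cv Cw arclengthE Is).
have hsign : \forall s \near 0^', 0 < ddist4 u v w s * s.
  apply: (ddist4_sign oI I0 Cu Cv Cw arclengthE (map_jet_height_deriv gamma0E)).
  by rewrite coef_map jet_height0; exact: rmorph1.
have P0 : (map_poly jet (jet_dist R))`_0 = 1.
  by rewrite coef_map jet_dist0; exact: rmorph1.
have m0 : m`_0 = 1 by rewrite coef_map M0; exact: rmorph1.
have hm : reversion (map_poly jet (jet_dist R)) m = 1 + 'X^7 * map_poly jet Q.
  rewrite -map_reversion hQ rmorphD; congr (_ + _); first exact: rmorph1.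
  by rewrite rmorphM; congr (_ * _); exact: map_polyXn.
have hd := sublevel_measure (isT : (0 < 6)%N) (isT : ~~ odd 6) hF hsign
  expands_curve_dist4 P0 m0 hm.
have hI : \forall d \near (0 : R)^'+, forall s : R, `|s| < d -> I s.
  have /nbhs_ballP[d0 /= d00 hd0] := open_nbhs_nbhs (conj oI I0).
  near=> d => s sd; apply: hd0.
  rewrite /ball /= sub0r normrN (lt_le_trans sd) //.
  by near: d; exact: nbhs_right_le.
near (0 : R)^'+ => d; exists d; split.
- by near: d; exact: nbhs_right_gt.
- by near: d.
- by have [] := near hd d.
- by have [] := near hd d.
Unshelve. all: by end_near. Qed.

End CurveExpansion.

Theorem proposition4p1 (R : realType) (c : R) (hc : normalizes_S2 c) :
  exists b1 b2 b3 : jet_poly R,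
    [/\ weighted_homogeneous (4 * 1) b1,
        weighted_homogeneous (4 * 2) b2,
        weighted_homogeneous (4 * 3) b3 &
        forall (I : set R) (S : R -> R * R * R),
          is_curve 6 I S -> I 0 ->
          nonhorizontal I S -> homogeneous_arclength I S ->
          let gamma : R -> R * R := piH \o S in
          exists2 e : R -> R,
            e =o_ (0^'+) (fun r : R => r ^+ 14) &
            \forall r \near 0^'+,
              sphericalS2 c (ballH (S 0) r `&` S @` I) =
              (2 * r ^+ 2 + jet_eval gamma b1 * r ^+ 6
               + jet_eval gamma b2 * r ^+ 10
               + jet_eval gamma b3 * r ^+ 14 + e r)%:E].
Proof.
(* [M] is found before any curve is introduced, so its coefficients are universal. *)
have [M [gM M0 sM [Q hQ]]] := reversion_solve 6 (graded_dist R) (jet_dist0 R).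
(* The even coefficients are doubled by the sum over both sides of 0; the coefficient of index 2m
   has weight 4m. *)
exists (M`_2 *+ 2), (M`_4 *+ 2), (M`_6 *+ 2); split.
- by apply: rpredMn; exact: (gM 2%N).
- by apply: rpredMn; exact: (gM 4%N).
- by apply: rpredMn; exact: (gM 6%N).
move=> I S hS I0 nh ha gamma.
have [d [d0 dI intJ hJ]] := curve_sublevel_measure hS I0 ha M0 hQ.
set D := dist4 _ _ _ in intJ hJ; set m := map_poly _ M in hJ.
have {}hJ e : 0 < e -> \forall r \near 0^'+,
    lebesgue_measure [set s | `|s| < d /\ D s <= (r ^+ 2) ^+ 2] \is a fin_num /\
    `|fine (lebesgue_measure [set s | `|s| < d /\ D s <= (r ^+ 2) ^+ 2])
      - r ^+ 2 * (m.[r ^+ 2] + m.[- r ^+ 2])| <= e * (r ^+ 2) ^+ 7.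
  by move=> /hJ /at_right0_sqr.
(* For small r the part of the curve in the ball is the image of the sublevel set, an interval on
   which the normalization gives the length. *)
have S2E : \forall r \near 0^'+, sphericalS2 c (ballH (S 0) r `&` S @` I) =
    lebesgue_measure [set s | `|s| < d /\ D s <= (r ^+ 2) ^+ 2].
  near=> r.
  have r0 : 0 < r by near: r; exact: nbhs_right_gt.
  have small : forall s, I s -> dH (S 0) (S s) <= r -> `|s| < d.
    by near: r; exact: small_ball_parameter hS I0 d0.
  rewrite -(sphericalS2_arclength hc (is_curveW hS) nh ha) //; last first.
    by move=> s [/dI].
  congr sphericalS2; apply/seteqP; split.
    move=> y [/= hr [s Is sy]]; exists s => //=; rewrite -sy in hr.
    by rewrite /D -(dH_curve_le _ _ r0); split => //; exact: small.
  move=> _ [s /= [sd sD] <-]; split; last by exists s => //; exact: dI.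
  by rewrite /ballH /= (dH_curve_le _ _ r0).
have polyE r : r ^+ 2 * (m.[r ^+ 2] + m.[- r ^+ 2]) =
  2 * r ^+ 2 + jet_eval gamma (M`_2 *+ 2) * r ^+ 6
    + jet_eval gamma (M`_4 *+ 2) * r ^+ 10
    + jet_eval gamma (M`_6 *+ 2) * r ^+ 14.
  rewrite horner_even_part; last 2 first.
  - by rewrite (leq_trans (size_poly _ _)).
  - by rewrite coef_map M0; exact: rmorph1.
  by rewrite !coef_map /= /jet_eval !mevalMn; ring.
(* The exact remainder; [hJ] bounds it by an arbitrary multiple of r^14. *)
exists (fun r => fine (sphericalS2 c (ballH (S 0) r `&` S @` I))
   - r ^+ 2 * (m.[r ^+ 2] + m.[- r ^+ 2])).
  apply/eqoP => e e0; have hJe := hJ e e0; near=> r.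
  have r0 : 0 < r by near: r; exact: nbhs_right_gt.
  have -> : sphericalS2 c (ballH (S 0) r `&` S @` I) =
    lebesgue_measure [set s | `|s| < d /\ D s <= (r ^+ 2) ^+ 2] by near: r.
  rewrite [X in _ <= _ * X]ger0_norm; last by rewrite exprn_ge0 // ltW.
  rewrite -[14%N]/(2 * 7)%N exprM.
  by case: (near hJe r).

(* The tolerance 1 is arbitrary: only finiteness of the measure is used, so that [fine] loses
   nothing. *)
have hJ1 := hJ 1 ltr01; near=> r.
rewrite -polyE addrC subrK fineK //.
have -> : sphericalS2 c (ballH (S 0) r `&` S @` I) =
  lebesgue_measure [set s | `|s| < d /\ D s <= (r ^+ 2) ^+ 2] by near: r.
by case: (near hJ1 r).
Unshelve. all: by end_near. Qed.
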